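(* The affine (spectral) Bernstein basis $\mathcal B^n_k(\xi)=\binom nk u(\xi)^kv(\xi)^{n-k}$, $0\le k\le n$, satisfies the degree-elevation recurrence $$\mathcal B^n_k(\xi)=\frac{n+1-k}{n+1}\,\mathcal B^{n+1}_k(\xi)+\frac{k+1}{n+1}\,\mathcal B^{n+1}_{k+1}(\xi),$$ and, for a polynomial $P(\xi)=\sum_{k}c_k\mathcal B^n_k(\xi)$, the de Casteljau recursion $$c^{(0)}_k=c_k,\qquad c^{(r)}_k=v(\xi)\,c^{(r-1)}_k+u(\xi)\,c^{(r-1)}_{k+1}$$ terminates at $P(\xi)=c^{(n)}_0$. Both are convex combinations for $\xi\in[\xi_0,\xi_1]$.
   Context: Here $\xi$ is the spectral variable of a quadratic or $q$-quadratic lattice ($\xi=x(s)=c_2s^2+c_1s+c_0$ on the quadratic lattice; $\xi=x=\cos\theta=\frac12(q^s+q^{-s})$, with $q^s=e^{i\theta}$, on the $q$-quadratic lattice), $[\xi_0,\xi_1]$ is a fixed interval containing the lattice support, and the barycentric coordinates are $$u(\xi)=\frac{\xi-\xi_0}{\xi_1-\xi_0},\qquad v(\xi)=\frac{\xi_1-\xi}{\xi_1-\xi_0},\qquad u(\xi)+v(\xi)=1.$$ In the recursion, $1\le r\le n$ and $0\le k\le n-r$, as usual for the de Casteljau algorithm.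
   Formalization: The degree-elevation weights of the basis recurrence sum to (n+2)/(n+1), so it is not a convex combination; proved instead: these weights are nonnegative, and each degree-elevated coefficient of P is a convex combination of adjacent c_k (equal to c_0, c_n at the ends). *)

(* Defs.v *)
From mathcomp Require Import all_boot all_order all_algebra.
From mathcomp Require Import all_classical all_reals all_analysis.

Set Implicit Arguments.
Unset Strict Implicit.
Unset Printing Implicit Defensive.

Import Order.TTheory GRing.Theory Num.Theory.
Local Open Scope ring_scope.

(* The two families of lattices are given by a real parameter: s itself on the
   quadratic lattice, and theta on the q-quadratic lattice, where
   q^s = e^(i theta), so that (q^s + q^-s) / 2 = cos theta. *)
Definition quadratic_lattice (R : realType) (x : R -> R) : Prop :=
  exists c2 c1 c0 : R, forall s, x s = c2 * s ^+ 2 + c1 * s + c0.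

Definition q_quadratic_lattice (R : realType) (x : R -> R) : Prop :=
  forall theta, x theta = cos theta.

Definition bary_u (R : realType) (xi0 xi1 xi : R) : R :=
  (xi - xi0) / (xi1 - xi0).

Definition bary_v (R : realType) (xi0 xi1 xi : R) : R :=
  (xi1 - xi) / (xi1 - xi0).

Definition bernstein (R : realType) (xi0 xi1 : R) (n k : nat) (xi : R) : R :=
  'C(n, k)%:R * bary_u xi0 xi1 xi ^+ k * bary_v xi0 xi1 xi ^+ (n - k).

(* Only the entries with r + k <= n are meaningful for a polynomial of degree
   at most n with Bernstein coefficients c 0, ..., c n. *)
Fixpoint de_casteljau (R : realType) (xi0 xi1 : R) (c : nat -> R) (xi : R)
    (r k : nat) : R :=
  if r is r'.+1 then
    bary_v xi0 xi1 xi * de_casteljau xi0 xi1 c xi r' k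
    + bary_u xi0 xi1 xi * de_casteljau xi0 xi1 c xi r' k.+1
  else c k.

(* Weights of B^(n+1)_k and of B^(n+1)_(k+1) in the degree elevation of
   B^n_k. *)
Definition elev_same (R : realType) (n k : nat) : R :=
  (n.+1%:R - k%:R) / n.+1%:R.

Definition elev_next (R : realType) (n k : nat) : R :=
  k.+1%:R / n.+1%:R.

(* Degree elevation on coefficients: B^(n+1)_j receives elev_same n j from
   B^n_j and elev_next n j.-1 = j / (n + 1) from B^n_(j-1); the first weight
   vanishes at j = n + 1, and there is no second contribution at j = 0. *)
Definition elevated_coef (R : realType) (n : nat) (c : nat -> R) (j : nat) : R :=
  if j is i.+1 then elev_same R n j * c j + elev_next R n i * c i
  else elev_same R n 0 * c 0%N.

Definition convex_combination (R : realType) (a b y z w : R) : Prop :=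
  [/\ 0 <= a, 0 <= b, a + b = 1 & w = a * y + b * z].

(* Main.v *)
(* Both recursions come from multiplying by 1 = u + v: with
   (n + 1 - k) C(n + 1, k) = (n + 1) C(n, k) = (k + 1) C(n + 1, k + 1) this
   elevates the degree, and with Pascal's rule it gives
   B^(r+1)_(i+1) = v B^r_(i+1) + u B^r_i, whence by induction
   c^(r)_k = sum_i c_(k+i) B^r_i. *)

Require Import Defs.
From mathcomp Require Import all_boot all_order all_algebra.
From mathcomp Require Import all_classical all_reals all_analysis.
From mathcomp Require Import ring.

Import Order.TTheory GRing.Theory Num.Theory.
Local Open Scope ring_scope.

(** Both recursions yield two sums, one of which lags by an index. As [f m.+1 = 0], the first sum
    may be extended by one term and then split at its head, which aligns [f k.+1] with [g k]. *)
Lemma sum_shift_add (V : zmodType) (m : nat) (f g : nat -> V) :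
  f m.+1 = 0 ->
  \sum_(k < m.+1) f k + \sum_(k < m.+1) g k
  = f 0%N + \sum_(k < m.+1) (f k.+1 + g k).
Proof.
move=> fm; rewrite big_split /= addrA; congr (_ + _).
rewrite -(big_ord_recl m.+1 (fun i => f i)).
by rewrite [RHS]big_ord_recr /= fm addr0.
Qed.

Section Bernstein.
Context (R : realType) (xi0 xi1 : R).
Implicit Types (xi : R) (c : nat -> R) (n k r : nat).

Local Notation u := (bary_u xi0 xi1).
Local Notation v := (bary_v xi0 xi1).
Local Notation B := (bernstein xi0 xi1).

Lemma bary_vDu xi : xi0 != xi1 -> v xi + u xi = 1.
Proof.
by move=> ne; rewrite /bary_u /bary_v -mulrDl addrA subrK divff // subr_eq0 eq_sym.
Qed.

Lemma bary_u_ge0 xi : xi0 <= xi1 -> xi0 <= xi -> 0 <= u xi.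
Proof. by move=> ? ?; rewrite divr_ge0 // subr_ge0. Qed.

Lemma bary_v_ge0 xi : xi0 <= xi1 -> xi <= xi1 -> 0 <= v xi.
Proof. by move=> ? ?; rewrite divr_ge0 // subr_ge0. Qed.

Lemma bernstein_small n k xi : (n < k)%N -> B n k xi = 0.
Proof. by move=> ltnk; rewrite /bernstein bin_small // !mul0r. Qed.

Lemma bernsteinS0 n xi : B n.+1 0 xi = v xi * B n 0 xi.
Proof. by rewrite /bernstein !bin0 !subn0 exprS; ring. Qed.

Lemma bernsteinSS n k xi :
  B n.+1 k.+1 xi = v xi * B n k.+1 xi + u xi * B n k xi.
Proof.
(* For [n <= k] truncated subtraction breaks [v * v ^+ (n - k.+1) = v ^+ (n - k)], but there
   [B n k.+1] vanishes. *)
have [ltkn|lenk] := ltnP k n; last first.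
  rewrite (@bernstein_small n k.+1) // /bernstein binS subSS exprS.
  by rewrite bin_small // add0n; ring.
rewrite /bernstein binS natrD subSS -[(n - k)%N]prednK ?subn_gt0 // -subnS.
by rewrite !exprS; ring.
Qed.

Lemma bernstein_elevation n k xi : xi0 != xi1 -> (k <= n)%N ->
  B n k xi = elev_same R n k * B n.+1 k xi + elev_next R n k * B n.+1 k.+1 xi.
Proof.
move=> ne lekn; have n1 : n.+1%:R != 0 :> R by rewrite pnatr_eq0.
have same : (n.+1%:R - k%:R) * 'C(n.+1, k)%:R = n.+1%:R * 'C(n, k)%:R :> R.
  by rewrite -natrB ?leqW // -!natrM -mul_bin_down.
have next : k.+1%:R * 'C(n.+1, k.+1)%:R = n.+1%:R * 'C(n, k)%:R :> R.
  by rewrite -!natrM -mul_bin_diag.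
rewrite -[LHS]mul1r -(bary_vDu xi ne) /elev_same /elev_next /bernstein.
rewrite subSS subSn // !exprS; apply: (mulfI n1).
(* The factor [n.+1%:R * 'C(n, k)%:R] is kept intact in both summands, so that [same] can rewrite
   one copy and [next] the other. *)
transitivity ((n.+1%:R * 'C(n, k)%:R) * (u xi ^+ k * (v xi * v xi ^+ (n - k)))
  + (n.+1%:R * 'C(n, k)%:R) * (u xi * u xi ^+ k * v xi ^+ (n - k))).
  by ring.
by rewrite -{1}same -next; field.
Qed.

(** The offset [k] stays general because step [r.+1] at [k] calls step [r] at both [k] and
    [k.+1]. *)
Lemma de_casteljauE c xi r k :
  de_casteljau xi0 xi1 c xi r k = \sum_(i < r.+1) c (k + i)%N * B r i xi.
Proof.
elim: r k => [|r IHr] k.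
  by rewrite big_ord1 /bernstein bin0 !mulr1 addn0.
rewrite /= !IHr !mulr_sumr.
rewrite (sum_shift_add _ r (fun i => v xi * (c (k + i)%N * B r i xi))
  (fun i => u xi * (c (k.+1 + i)%N * B r i xi))); last first.
  by rewrite bernstein_small // !mulr0.
rewrite [RHS]big_ord_recl bernsteinS0 /=; congr (_ + _); first by ring.
by apply: eq_bigr => i _; rewrite /bump add1n bernsteinSS addnS addSn; ring.
Qed.

Lemma bernstein_sum_elevation c n xi : xi0 != xi1 ->
  \sum_(k < n.+1) c k * B n k xi
  = \sum_(j < n.+2) elevated_coef n c j * B n.+1 j xi.
Proof.
move=> ne.
under eq_bigr => k _ do
  rewrite bernstein_elevation ?(leq_ord k) // mulrDr.
rewrite big_split /=.
(* The shift introduces the arbitrary value [c n.+1]; its weight [elev_same R n n.+1] is zero. *)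
rewrite (sum_shift_add _ n (fun k => c k * (elev_same R n k * B n.+1 k xi))
  (fun k => c k * (elev_next R n k * B n.+1 k.+1 xi))); last first.
  by rewrite /elev_same subrr !mul0r mulr0.
rewrite [RHS]big_ord_recl /=; congr (_ + _); first by ring.
by apply: eq_bigr => i _; rewrite /bump add1n; ring.
Qed.

End Bernstein.

Lemma elev_same_ge0 (R : realType) n k : (k <= n.+1)%N -> 0 <= elev_same R n k.
Proof. by move=> lekn; rewrite divr_ge0 // subr_ge0 ler_nat. Qed.

Lemma elev_next_ge0 (R : realType) n k : 0 <= elev_next R n k.
Proof. by rewrite divr_ge0. Qed.

(** The indices differ because these are the two weights received by one coefficient of degree n +
    1. The weights leaving one basis element, both at [k], add up to (n + 2) / (n + 1) instead. *)
Lemma elev_sameDnext (R : realType) n k :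
  elev_same R n k.+1 + elev_next R n k = 1.
Proof. by rewrite -mulrDl subrK divff. Qed.

Theorem proposition4p3 (R : realType)
  (x : R -> R)
  (hx : quadratic_lattice x \/ q_quadratic_lattice x)
  (support : set R)
  (xi0 xi1 : R)
  (hlt : xi0 < xi1)
  (hsupport : forall s, support s -> xi0 <= x s <= xi1)
  (n : nat) :
  (* degree elevation of the basis *)
  (forall (k : nat) (xi : R), (k <= n)%N ->
     bernstein xi0 xi1 n k xi
     = (n.+1%:R - k%:R) / n.+1%:R * bernstein xi0 xi1 n.+1 k xi
       + k.+1%:R / n.+1%:R * bernstein xi0 xi1 n.+1 k.+1 xi)
  /\
  (forall (P : {poly R}) (c : nat -> R),
     (forall xi, P.[xi] = \sum_(k < n.+1) c k * bernstein xi0 xi1 n k xi) ->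
     [/\ (* de Casteljau recursion *)
         forall xi, de_casteljau xi0 xi1 c xi n 0 = P.[xi],
         (* each de Casteljau step is a convex combination *)
         forall xi, xi0 <= xi <= xi1 ->
           forall r k, (1 <= r <= n)%N -> (k <= n - r)%N ->
             convex_combination (bary_v xi0 xi1 xi) (bary_u xi0 xi1 xi)
               (de_casteljau xi0 xi1 c xi r.-1 k)
               (de_casteljau xi0 xi1 c xi r.-1 k.+1)
               (de_casteljau xi0 xi1 c xi r k),
         (* degree elevation of the coefficients of P *)
         forall xi, P.[xi] = \sum_(j < n.+2)
                      elevated_coef n c j * bernstein xi0 xi1 n.+1 j xi &
         (* it has nonnegative weights, and each elevated coefficient is a
            convex combination *)
         [/\ forall k, (k <= n)%N ->
               0 <= elev_same R n k /\ 0 <= elev_next R n k,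
             elevated_coef n c 0 = c 0%N,
             elevated_coef n c n.+1 = c n
           & forall j, (j < n)%N ->
               convex_combination (elev_same R n j.+1) (elev_next R n j)
                 (c j.+1) (c j) (elevated_coef n c j.+1)]]).
Proof.
have ne : xi0 != xi1 by rewrite lt_eqF.
split=> [k xi|P c Pc]; first exact: bernstein_elevation.
split.
- by move=> xi; rewrite de_casteljauE Pc.
- move=> xi /andP[le0 le1] [//|r] k _ _.
  by split; [apply: bary_v_ge0 (ltW hlt) le1|apply: bary_u_ge0 (ltW hlt) le0
            |apply: bary_vDu|].
- by move=> xi; rewrite Pc; apply: bernstein_sum_elevation.
split.
- by move=> k lekn; rewrite elev_same_ge0 ?leqW // elev_next_ge0.
- by rewrite /= /elev_same subr0 divff ?mul1r.
(* At the last index the weights are 0 and 1, so [c n.+1] drops out. *)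
- by rewrite /= /elev_same /elev_next subrr !mul0r add0r divff ?mul1r.
- move=> j ltjn; split=> //; [|exact: elev_next_ge0|exact: elev_sameDnext].
  by rewrite elev_same_ge0 // ltnS ltnW.
Qed.
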